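(* For every positive integer $j$, let $J_j$ be the graph constructed as follows. Take a star $K_{1,3^j}$ with center $c$, and label its leaves bijectively by the ternary strings of length $j$. Add $2j$ new vertices $s_1,\dots,s_j,r_1,\dots,r_j$, where for each $i$: $s_i$ is adjacent to every leaf whose label has $i$-th digit $0$; $r_i$ is adjacent to every leaf whose label has $i$-th digit $0$ or $1$; and $r_i$ is adjacent to $s_i$ (no other edges). Finally delete the leaf labeled by the all-$1$ string and the $j$ leaves whose labels contain exactly one $0$ and $j-1$ ones. Then for all integers $k\ge 2$ and $j\ge 1$, $\dim_k(J_j)=j$ and $\textnormal{ftdim}_k(J_j)\ge 3^{j-1}-j$.
   Context: Graphs are finite, simple, undirected. For a positive integer $k$, a set $S=\{v_1,\dots,v_m\}$ of vertices is a $k$-resolving set of $G$ if the vectors $(\min(k+1,\textnormal{dist}(u,v_1)),\dots,\min(k+1,\textnormal{dist}(u,v_m)))$ are pairwise distinct over $u\in V(G)$. $\dim_k(G)$ is the minimum size of a $k$-resolving set; $\textnormal{ftdim}_k(G)$ is the minimum size of a nonempty $S\subseteq V(G)$ such that $S-\{s\}$ is a $k$-resolving set for every $s\in S$.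
   Formalization: The equality dim_k(J_j)=j is proved only for j≥2; for j=1 it is false, since J_1 is the disjoint union of the edges c–(leaf 2) and s_1–r_1, which no single vertex resolves. The bound on ftdim_k is proved for all j≥1. *)

(* Defs.v *)
From HB Require Import structures.
From mathcomp Require Import all_boot.

Set Implicit Arguments.
Unset Strict Implicit.
Unset Printing Implicit Defensive.

Record sgraph := SGraph {
  vertex :> finType;
  adj : rel vertex;
  adj_sym : symmetric adj;
  adj_irrefl : irreflexive adj }.

Section Graphs.
Variable G : sgraph.
Implicit Types (x y u v w : G) (S : {set G}).

Definition has_walk x y n :=
  [exists p : n.-tuple G, path (@adj G) x p && (last x p == y)].

Lemma connect_walk x y : connect (@adj G) x y -> exists n, has_walk x y n.
Proof.
case/connectP=> p xp ->; exists (size p).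
by apply/existsP; exists (in_tuple p); rewrite /= xp eqxx.
Qed.

(* None stands for infinite distance (different connected components). *)
Definition dist x y : option nat :=
  if decP (@idP (connect (@adj G) x y)) is left xy
  then Some (ex_minn (connect_walk xy)) else None.

(* min(k+1, dist x y), where min(k+1, oo) = k+1 *)
Definition trunc_dist k x y : nat :=
  if dist x y is Some n then minn k.+1 n else k.+1.

Definition dist_vector k S u : seq nat := [seq trunc_dist k u v | v <- enum S].

Definition k_resolving k S : bool := injectiveb (dist_vector k S).

Definition ft_k_resolving k S : bool :=
  (S != set0) && [forall s in S, k_resolving k (S :\ s)].

(* [arg min] needs a feasible starting set: the full vertex set is always
   k-resolving, and always feasible for ftdim when G is nonempty
   (k_resolvingT and ft_k_resolvingT below). *)
Definition dim k : nat := #|[arg min_(S < [set: G] | k_resolving k S) #|S| ]|.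

Definition ftdim k : nat :=
  #|[arg min_(S < [set: G] | ft_k_resolving k S) #|S| ]|.

Lemma dist_None x y : (dist x y == None) = ~~ connect (@adj G) x y.
Proof. by rewrite /dist; case: decP => [c|/negP->//]; rewrite c. Qed.

Lemma dist_xx x : dist x x = Some 0.
Proof.
rewrite /dist; case: decP => [c|[]]; last exact: connect0.
case: ex_minnP => m _ /(_ 0); rewrite leqn0 => min_m; congr Some; apply/eqP.
by apply: min_m; apply/existsP; exists [tuple]; rewrite /= eqxx.
Qed.

Lemma dist_eq0 x y : dist x y = Some 0 -> x = y.
Proof.
rewrite /dist; case: decP => [c|//].
case: ex_minnP => m /existsP[p /andP[_ /eqP <-]] _ [m0].
by move: p; rewrite m0 => p; rewrite tuple0.
Qed.

Lemma trunc_dist_eq0 k x y : (trunc_dist k x y == 0) = (x == y).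
Proof.
apply/eqP/eqP => [|->]; last by rewrite /trunc_dist dist_xx minn0.
rewrite /trunc_dist; case E: (dist x y) => [[|n]|//]; last by rewrite minnSS.
by move=> _; apply: dist_eq0.
Qed.

Lemma k_resolvingP k S :
  reflect (forall u w,
             (forall v, v \in S -> trunc_dist k u v = trunc_dist k w v) ->
             u = w)
          (k_resolving k S).
Proof.
apply: (iffP (injectiveP _)) => inj u w uw; apply: inj.
  by apply/eq_in_map => v; rewrite mem_enum; apply: uw.
by move=> v vS; move/eq_in_map: uw; apply; rewrite mem_enum.
Qed.

Lemma k_resolvingT k : k_resolving k [set: G].
Proof.
apply/k_resolvingP => u w uw; apply/eqP; rewrite -(trunc_dist_eq0 k).
by rewrite uw ?inE // trunc_dist_eq0.
Qed.

Lemma ft_k_resolvingT k x : ft_k_resolving k [set: G].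
Proof.
apply/andP; split; first by apply/set0Pn; exists x.
apply/forall_inP => s _; apply/k_resolvingP => u w uw.
have d0 z : trunc_dist k z z = 0 by apply/eqP; rewrite trunc_dist_eq0.
have [ws|nws] := eqVneq w s; last first.
  by apply/eqP; rewrite -(trunc_dist_eq0 k) uw ?d0 // !inE nws.
have [us|nus] := eqVneq u s; first by rewrite us ws.
by apply/esym/eqP; rewrite -(trunc_dist_eq0 k) -uw ?d0 // !inE nus.
Qed.

Definition induced_rel (A : {set G}) : rel {x : G | x \in A} :=
  fun a b => adj (val a) (val b).

Lemma induced_sym A : symmetric (@induced_rel A).
Proof. by move=> x y; apply: adj_sym. Qed.

Lemma induced_irrefl A : irreflexive (@induced_rel A).
Proof. by move=> x; apply: adj_irrefl. Qed.

Definition induced A : sgraph := SGraph (@induced_sym A) (@induced_irrefl A).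

End Graphs.

Section Construction.
Variable j : nat.

(* Ternary strings of length j; position i here is the (i+1)-st digit. *)
Definition label := j.-tuple 'I_3.

Inductive Jvertex := Center | Leaf of label | Svert of 'I_j | Rvert of 'I_j.

Definition Jencode (x : Jvertex) : unit + label + ('I_j + 'I_j) :=
  match x with
  | Center => inl (inl tt)
  | Leaf l => inl (inr l)
  | Svert i => inr (inl i)
  | Rvert i => inr (inr i)
  end.

Definition Jdecode (x : unit + label + ('I_j + 'I_j)) : Jvertex :=
  match x with
  | inl (inl _) => Center
  | inl (inr l) => Leaf l
  | inr (inl i) => Svert i
  | inr (inr i) => Rvert i
  end.

Lemma JencodeK : cancel Jencode Jdecode.
Proof. by case. Qed.

HB.instance Definition _ := Finite.copy Jvertex (can_type JencodeK).

Definition Jarc (x y : Jvertex) : bool :=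
  match x, y with
  | Center, Leaf _ => true
  | Svert i, Leaf l => tnth l i == 0 :> nat
  | Rvert i, Leaf l => (tnth l i == 0 :> nat) || (tnth l i == 1 :> nat)
  | Rvert i, Svert i' => i == i'
  | _, _ => false
  end.

Definition Jadj : rel Jvertex := fun x y => Jarc x y || Jarc y x.

Lemma Jadj_sym : symmetric Jadj.
Proof. by move=> x y; apply: orbC. Qed.

Lemma Jadj_irrefl : irreflexive Jadj.
Proof. by case. Qed.

Definition Jfull : sgraph := SGraph Jadj_sym Jadj_irrefl.

Definition count_digit (n : nat) (l : label) : nat :=
  count (fun d : 'I_3 => d == n :> nat) l.

Definition deleted_label (l : label) : bool :=
  (count_digit 1 l == j)
  || (count_digit 0 l == 1) && (count_digit 1 l == j - 1).

Definition deleted : {set Jfull} :=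
  [set x : Jfull | if x is Leaf l then deleted_label l else false].

Definition J : sgraph := induced (~: deleted).

End Construction.

(* J 1 is the disjoint union of the edges {c, leaf 2} and {s_1, r_1}, so no
   single vertex is k-resolving: dim (J j) k = j can only hold for j >= 2. *)
Section J1.

Let in_c : Center 1 \in ~: deleted 1. Proof. by rewrite !inE. Qed.
Let in_s : Svert ord0 \in ~: deleted 1. Proof. by rewrite !inE. Qed.
Let in_r : Rvert ord0 \in ~: deleted 1. Proof. by rewrite !inE. Qed.
Let in_l : Leaf [tuple (@ord_max 2)] \in ~: deleted 1.
Proof. by rewrite !inE. Qed.

Let vtx (x : Jfull 1) (xJ : x \in ~: deleted 1) : J 1 :=
  exist (fun x => x \in ~: deleted 1) x xJ.

Let star_part : pred (J 1) :=
  fun x => match val x with Center | Leaf _ => true | _ => false end.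

Let star_part_closed : closed (@adj (J 1)) star_part.
Proof.
move=> [x xJ] [y yJ].
rewrite /= /induced_rel /= /Jadj unfold_in /= [RHS]unfold_in /star_part /=.
have two (l : label 1) i :
    Leaf l \in ~: deleted 1 ->
    (tnth l i == 0 :> nat) || (tnth l i == 1 :> nat) = false.
  rewrite !inE /deleted_label /count_digit (ord1 i).
  case: l => [[|a [|]] //= ?]; rewrite (tnth_nth ord0) /=.
  by case: a => [[|[|[|]]]].
case: x xJ => [|l|i|i] xJ; case: y yJ => [|l'|i'|i'] yJ //=; rewrite ?orbF.
- by have /norP[/negPf->] := negbT (two _ i' xJ).
- by rewrite two.
- by have /norP[/negPf->] := negbT (two _ i yJ).
- by rewrite two.
Qed.

Let trunc_dist_far k (x y : J 1) :
  star_part x != star_part y -> trunc_dist k x y = k.+1.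
Proof.
move=> xy; have /eqP : dist x y == None.
  rewrite dist_None; apply: contra xy => c.
  by apply/eqP; have := closed_connect star_part_closed c.
by rewrite /trunc_dist => ->.
Qed.

Lemma dim_J1 k : dim (J 1) k <> 1.
Proof.
rewrite /dim; case: arg_minnP => [|S /k_resolvingP res _ /eqP/cards1P[v Sv]].
  exact: k_resolvingT.
have eq_far (x y : J 1) :
    star_part x != star_part v -> star_part y != star_part v -> x = y.
  by move=> xv yv; apply: res => w; rewrite Sv inE => /eqP->;
     rewrite !trunc_dist_far.
case vE: (star_part v).
  have := eq_far (vtx in_s) (vtx in_r).
  by rewrite vE => /(_ isT isT) [].
have := eq_far (vtx in_c) (vtx in_l).
by rewrite vE => /(_ isT isT) [].
Qed.

End J1.

(* Main.v *)
(* The all-0 leaf is adjacent to the center and to every s_i and r_i, so every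
   relevant distance is at most 3.  The distance from s_i to a leaf is its i-th
   digit plus 1, so s_1, ..., s_j separate the leaves; the center would look like
   the all-1 leaf and r_i like the leaf with a single 0 at i, but these leaves
   were deleted.  Conversely distances from a leaf outside S to S take only the
   values 1, 2, 3, and counting leaves gives |S| >= j.
   Two leaves that differ only in the first digit, being 0 and 1, are separated
   only by s_1 and by themselves.  Removing s_1 if present, a fault-tolerant set
   must hence meet each of these disjoint pairs, and at most j of the 3^(j-1)
   pairs are hit by the deletion of leaves. *)
Require Import Defs.
From mathcomp Require Import all_boot.
From mathcomp Require Import zify.

Set Implicit Arguments.
Unset Strict Implicit.
Unset Printing Implicit Defensive.

(** * Truncated distances up to 3, read off from short walks *)

Section TruncatedDistance.
Variables (G : sgraph) (k : nat).
Implicit Types x y z : G.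

Lemma trunc_dist_path x p : path (@adj G) x p -> trunc_dist k x (last x p) <= size p.
Proof.
move=> xp; rewrite /trunc_dist /dist; case: decP => [c|[]]; last first.
  by apply/connectP; exists p.
case: ex_minnP => m _ /(_ (size p)) le_m; rewrite geq_min le_m ?orbT //.
by apply/existsP; exists (in_tuple p); rewrite /= xp eqxx.
Qed.

(** As [n <= k], the cap [k.+1] is never what makes the left side hold. *)
Lemma trunc_dist_leP x y n : n <= k ->
  reflect (exists p, [/\ size p <= n, path (@adj G) x p & last x p = y])
          (trunc_dist k x y <= n).
Proof.
move=> le_nk; apply: (iffP idP) => [|[p [le_p xp <-]]]; last first.
  exact: leq_trans (trunc_dist_path xp) le_p.
rewrite /trunc_dist /dist; case: decP => [c|_]; last by rewrite leqNgt ltnS le_nk.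
case: ex_minnP => m /existsP[p /andP[xp /eqP yp]] _.
rewrite geq_min leqNgt ltnS le_nk /= => le_m.
by exists p; rewrite size_tuple.
Qed.

Lemma trunc_dist_le1 x y : 0 < k -> (trunc_dist k x y <= 1) = (x == y) || adj x y.
Proof.
move=> k0; apply/(trunc_dist_leP _ _ k0)/orP => [[[|a [|b p]] [//= _]]|[/eqP<-|xy]].
- by move=> _ ->; left.
- by rewrite andbT => xa <-; right.
- by exists [::].
- by exists [:: y]; rewrite /= xy.
Qed.

Lemma trunc_dist_le2 x y : 1 < k ->
  (trunc_dist k x y <= 2) = [|| x == y, adj x y | [exists z, adj x z && adj z y]].
Proof.
move=> k1; apply/(trunc_dist_leP _ _ k1)/or3P.
  case=> [[|a [|b [|? ?]]] [//= _]].
  - by move=> _ ->; constructor 1.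
  - by rewrite andbT => xa <-; constructor 2.
  - by rewrite andbT => xab <-; constructor 3; apply/existsP; exists a.
case=> [/eqP<-|xy|/existsP[z xzy]].
- by exists [::].
- by exists [:: y]; rewrite /= xy.
- by exists [:: z; y]; rewrite /= andbT.
Qed.

Lemma trunc_dist_le3 x y a b :
  adj x a -> adj a b -> adj b y -> trunc_dist k x y <= 3.
Proof.
by move=> xa ab bby; apply: (@trunc_dist_path x [:: a; b; y]); rewrite /= xa ab bby.
Qed.

Hypothesis hk : 1 < k.

Lemma trunc_dist1 x y : adj x y -> trunc_dist k x y = 1.
Proof.
move=> xy; have := trunc_dist_le1 x y (ltnW hk).
have := trunc_dist_eq0 k x y; rewrite xy orbT.
by case: (eqVneq x y) xy => [->|_ _]; [rewrite adj_irrefl | lia].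
Qed.

Lemma trunc_dist2 x y z :
  x != y -> ~~ adj x y -> adj x z -> adj z y -> trunc_dist k x y = 2.
Proof.
move=> nxy axy xz zy; have := trunc_dist_le1 x y (ltnW hk).
rewrite (negPf nxy) (negPf axy) => gt1; have := trunc_dist_le2 x y hk.
have -> : [exists w, adj x w && adj w y] by apply/existsP; exists z; rewrite xz.
by rewrite !orbT; lia.
Qed.

(** Only distances up to 2 must be excluded, so [1 < k] suffices: for [k = 2] the cap itself is
    3. *)
Lemma trunc_dist3 x y a b :
    x != y -> ~~ adj x y -> (forall w, ~~ (adj x w && adj w y)) ->
    adj x a -> adj a b -> adj b y ->
  trunc_dist k x y = 3.
Proof.
move=> nxy axy no_mid xa ab bby; have := trunc_dist_le2 x y hk.
rewrite (negPf nxy) (negPf axy) (_ : [exists w, _] = false) ?orbF; last first.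
  by apply/existsP => -[w]; apply/negP.
by have := trunc_dist_le3 xa ab bby; lia.
Qed.

End TruncatedDistance.

(* The deleted labels: all ones for [None], a single 0 at position [m] for
   [Some m]. *)
Definition dlabel j (o : option 'I_j) : label j :=
  [tuple if o == Some i then ord0 else inord 1 | i < j].

(** * Shape and number of the deleted labels *)

Lemma I3_eqE (a : 'I_3) : [|| a == 0 :> nat, a == 1 :> nat | a == 2 :> nat].
Proof. by case: a => [[|[|[|]]]]. Qed.

Lemma count_digitE j n (l : label j) :
  count_digit n l = #|[set i | tnth l i == n :> nat]|.
Proof.
rewrite /count_digit -{1}[tval l]map_tnth_enum count_map -size_filter cardE /enum_mem.
rewrite -filter_predI; congr size; apply: eq_filter => i /=.
by rewrite !inE andbT.
Qed.

Lemma deleted_labelP j (l : label j) :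
  reflect (exists o, l = dlabel o) (deleted_label l).
Proof.
rewrite /deleted_label !count_digitE; apply: (iffP idP).
  case/orP => [/eqP c1|/andP[/cards1P[m m0] /eqP c1]].
    have /eqP/setP all1 : [set i | tnth l i == 1 :> nat] == [set: 'I_j].
      by rewrite eqEcard subsetT cardsT card_ord c1 leqnn.
    exists None; apply: eq_from_tnth => i; rewrite tnth_mktuple /=.
    by have := all1 i; rewrite !inE => /eqP i1; apply: val_inj; rewrite /= inordK.
  (* The j-1 ones all avoid [m], so by cardinality they fill its complement. *)
  have /eqP/setP all1 : [set i | tnth l i == 1 :> nat] == ~: [set m].
    rewrite eqEcard cardsC1 card_ord c1 subn1 leqnn andbT.
    apply/subsetP => i; rewrite !inE => /eqP i1; apply/eqP => im.
    by have := set11 m; rewrite -m0 inE -im i1.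
  exists (Some m); apply: eq_from_tnth => i; rewrite tnth_mktuple.
  have [[<-]|nmi] := eqVneq (Some m) (Some i).
    by have := set11 m; rewrite -m0 inE => /eqP mz; apply: val_inj.
  have := all1 i; rewrite !inE (eq_sym i) (inj_eq Some_inj) in nmi *.
  by rewrite nmi => /eqP i1; apply: val_inj; rewrite /= inordK.
case=> -[m|] ->; last first.
  rewrite (_ : [set i | _ == 1] = setT) ?cardsT ?card_ord ?eqxx //.
  by apply/setP => i; rewrite !inE tnth_mktuple /= inordK.
rewrite (_ : [set i | _ == 1] = ~: [set m]); last first.
  apply/setP => i; rewrite !inE tnth_mktuple (inj_eq Some_inj).
  by case: (eqVneq m i) => //= _; rewrite inordK.
rewrite (_ : [set i | _ == 0] = [set m]); last first.
  apply/setP => i; rewrite !inE tnth_mktuple (inj_eq Some_inj).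
  by case: (eqVneq m i) => //= _; rewrite inordK.
by rewrite cardsC1 cards1 card_ord subn1 !eqxx orbT.
Qed.

Lemma card_deleted_label j : #|[set l : label j | deleted_label l]| <= j.+1.
Proof.
have card_opt : #|{: option 'I_j}| = j.+1 by rewrite card_option card_ord.
rewrite -{}card_opt; apply: leq_trans (leq_imset_card (@dlabel j) _).
apply/subset_leq_card/subsetP => l; rewrite inE => /deleted_labelP[o ->].
exact: imset_f.
Qed.

(* All labels a :: t, for a deleted t, are excluded at once: so a pair of labels
   0 :: t, 1 :: t is lost only for the at most n+1 deleted t. *)
Lemma deleted_label_cons n (a : 'I_3) (t : n.-tuple 'I_3) :
  deleted_label ([tuple of a :: t] : label n.+1) -> deleted_label (t : label n).
Proof.
case/deleted_labelP => o at_o; apply/deleted_labelP.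
(* A single 0 in the tail has its position shifted down; a 0 at the head leaves an all-1 tail, that
   is [None]. *)
exists (obind (unlift ord0) o); apply: eq_from_tnth => i.
rewrite -(tnthS a) at_o !tnth_mktuple; congr (if _ then _ else _).
case: o {at_o} => [m|] //=.
by case: unliftP => [m'|] -> /=; rewrite !(inj_eq Some_inj) ?(inj_eq lift_inj).
Qed.

(** A deleted label cannot have 0 at both of the first two positions. For j = 1 the label 0 is
    itself deleted. *)
Lemma zero_label_kept j : 1 < j -> ~~ deleted_label ([tuple ord0 | _ < j] : label j).
Proof.
move=> j1; apply/deleted_labelP => -[o /(congr1 (fun l => tnth l)) zo].
have lt0 : 0 < j by apply: ltnW.
have := congr1 (fun f => f (Ordinal lt0)) zo; have := congr1 (fun f => f (Ordinal j1)) zo.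
rewrite !tnth_mktuple; case: eqP => [-> _|_ /(congr1 val)]; last by rewrite /= inordK.
by case: eqP => // _ /(congr1 val); rewrite /= inordK.
Qed.

(** * Passing between [J j] and the full graph *)

Section Vertices.
Variable j : nat.
Implicit Types (x y v : J j) (l : label j) (i m : 'I_j).

Lemma centerP : (Center j : Jfull j) \in ~: deleted j.
Proof. by rewrite !inE. Qed.

(* Junk value: deleted leaves are sent to the center. *)
Definition vtx (a : Jfull j) : J j :=
  insubd (exist (fun b => b \in ~: deleted j) _ centerP) a.

Lemma val_vtx (a : Jfull j) : a \notin deleted j -> val (vtx a) = a.
Proof. by move=> a_kept; rewrite insubdK // inE. Qed.

Lemma val_Leaf x l : val x = Leaf l -> ~~ deleted_label l.
Proof. by move=> xl; have := valP x; rewrite xl !inE. Qed.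

Definition leafv l := vtx (Leaf l).

Lemma val_leafv l : ~~ deleted_label l -> val (leafv l) = Leaf l.
Proof. by move=> l_kept; rewrite val_vtx // inE. Qed.

Lemma val_S i : val (vtx (Svert i)) = Svert i.
Proof. by rewrite val_vtx // inE. Qed.

Lemma val_R i : val (vtx (Rvert i)) = Rvert i.
Proof. by rewrite val_vtx // inE. Qed.

Lemma val_C : val (vtx (Center j)) = Center j.
Proof. by rewrite val_vtx // inE. Qed.

Lemma adjE x y : adj x y = Jadj (val x) (val y).
Proof. by []. Qed.

End Vertices.

(* The distances from an undeleted leaf [l] to [a], and from [a] to s_i, when
   [2 <= j]. *)
Definition leaf_dist j (l : label j) (a : Jvertex j) : nat :=
  match a with
  | Center => 1
  | Leaf l' => if l == l' then 0 else 2
  | Svert i => (tnth l i).+1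
  | Rvert i => if tnth l i <= 1 then 1 else 3
  end.

Definition S_dist j (a : Jvertex j) (i : 'I_j) : nat :=
  match a with
  | Center => 2
  | Leaf l => (tnth l i).+1
  | Svert m => if m == i then 0 else 2
  | Rvert m => if m == i then 1 else 2
  end.

Lemma leaf_dist_le3 j (l : label j) a : leaf_dist l a <= 3.
Proof. by case: a => [|l'|i|i] //=; [case: ifP | case: ifP]. Qed.

(** * Exact distances in [J j] and the value of [dim] *)

Section Distances.
Variables (k j : nat).
Hypotheses (hk : 1 < k) (hj : 1 < j).

Let z : J j := leafv [tuple ord0 | _ < j].

Let val_z : val z = Leaf [tuple ord0 | _ < j].
Proof. by rewrite val_leafv // zero_label_kept. Qed.

Let neq_val (x y : J j) : val x != val y -> x != y.
Proof. by apply: contraNneq => ->. Qed.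

(** Two leaves meet at the center. Digit 1 reaches s_i through r_i. With digit 2, no neighbour of
    the leaf is adjacent to s_i or r_i, and the walk through the center and the all-0 leaf [z] gives
    3. *)
Lemma trunc_dist_leaf (x v : J j) l :
  val x = Leaf l -> trunc_dist k x v = leaf_dist l (val v).
Proof.
move=> xl.
have adjC (y : J j) l' : val y = Leaf l' -> adj y (vtx (Center j)) * adj (vtx (Center j)) y.
  by move=> yl; rewrite !adjE yl val_C.
case vE: (val v) => [|l'|i|i] /=.
- by apply: trunc_dist1 => //; rewrite adjE xl vE.
- case: eqP => [ll'|nll'].
    by apply/eqP; rewrite trunc_dist_eq0; apply/eqP/val_inj; rewrite /= xl vE ll'.
  apply: (@trunc_dist2 _ _ hk _ _ (vtx (Center j))).
  + by apply: neq_val; rewrite xl vE; apply/eqP => -[].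
  + by rewrite adjE xl vE.
  + by rewrite (adjC _ _ xl).
  + by rewrite (adjC _ _ vE).
- have nxv : x != v by apply: neq_val; rewrite xl vE.
  case/or3P: (I3_eqE (tnth l i)) => /eqP d; rewrite d.
  + by apply: trunc_dist1 => //; rewrite adjE xl vE /Jadj /= d.
  + apply: (@trunc_dist2 _ _ hk _ _ (vtx (Rvert i))) => //.
    * by rewrite adjE xl vE /Jadj /= d.
    * by rewrite adjE xl val_R /Jadj /= d.
    * by rewrite adjE vE val_R /Jadj /= eqxx.
  + apply: (@trunc_dist3 _ _ hk _ _ (vtx (Center j)) z) => //.
    * by rewrite adjE xl vE /Jadj /= d.
    * move=> w; rewrite !adjE xl vE /Jadj; case: (val w) => [|l'|m|m] //=; rewrite ?orbF ?andbF //.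
      by apply/negP => /andP[lm /eqP mi]; subst m; lia.
    * by rewrite (adjC _ _ xl).
    * by rewrite (adjC _ _ val_z).
    * by rewrite adjE val_z vE /Jadj /= tnth_mktuple.
- have nxv : x != v by apply: neq_val; rewrite xl vE.
  case: leqP => d.
    by apply: trunc_dist1 => //; rewrite adjE xl vE /Jadj /=; lia.
  apply: (@trunc_dist3 _ _ hk _ _ (vtx (Center j)) z) => //.
  + by rewrite adjE xl vE /Jadj /=; lia.
  + move=> w; rewrite !adjE xl vE /Jadj; case: (val w) => [|l'|m|m] //=; rewrite ?orbF ?andbF //.
    by apply/negP => /andP[lm /eqP mi]; subst m; lia.
  + by rewrite (adjC _ _ xl).
  + by rewrite (adjC _ _ val_z).
  + by rewrite adjE val_z vE /Jadj /= tnth_mktuple.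
Qed.

(** Every non-leaf is adjacent to [z], as is s_i, so it lies at distance 2 from s_i unless equal or
    adjacent to it. *)
Lemma trunc_dist_S (x : J j) i : trunc_dist k x (vtx (Svert i)) = S_dist (val x) i.
Proof.
have adj_zS : adj z (vtx (Svert i)) by rewrite adjE val_z val_S /Jadj /= tnth_mktuple.
have at2 : val x != Svert i -> ~~ adj x (vtx (Svert i)) -> adj x z ->
    trunc_dist k x (vtx (Svert i)) = 2.
  move=> nxv axv xz; apply: (trunc_dist2 hk _ axv xz adj_zS).
  by apply: neq_val; rewrite val_S.
rewrite !adjE val_S val_z /Jadj in at2.
case xE: (val x) at2 => [|l|m|m] at2 /=.
- by apply: at2.
- by rewrite (trunc_dist_leaf _ xE) val_S.
- case: eqP => [mi|nmi].
    by apply/eqP; rewrite trunc_dist_eq0 -(inj_eq val_inj) /= xE val_S mi.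
  by apply: at2; rewrite //= ?tnth_mktuple //; apply/eqP => -[].
- case: eqP => [mi|nmi].
    by apply: trunc_dist1 => //; rewrite adjE xE val_S /Jadj /= mi eqxx.
  by apply: at2; rewrite //= ?tnth_mktuple // orbF; apply/eqP.
Qed.

Lemma S_resolving : k_resolving k [set vtx (Svert i) | i : 'I_j].
Proof.
(* Records that leaf labels are undeleted before the case analysis on [val u] and [val w]. *)
apply/k_resolvingP => u w uw; apply: val_inj; move: (val_Leaf (x := u)) (val_Leaf (x := w)).
have {uw} : forall i, S_dist (val u) i = S_dist (val w) i.
  by move=> i; rewrite -!trunc_dist_S; apply: uw; apply: imset_f.
have noC (l : label j) : (forall i, (tnth l i).+1 = 2) -> deleted_label l.
  move=> all1; apply/deleted_labelP; exists None; apply: eq_from_tnth => i.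
  by rewrite tnth_mktuple; apply: val_inj; rewrite /= inordK //; case: (all1 i).
have noR (l : label j) m : (forall i, (tnth l i).+1 = if m == i then 1 else 2) -> deleted_label l.
  move=> all1; apply/deleted_labelP; exists (Some m); apply: eq_from_tnth => i.
  rewrite tnth_mktuple (inj_eq Some_inj); apply: val_inj; have := all1 i.
  by case: eqP => _ [] /= ->; rewrite ?inordK.
(* A leaf against the center or some r_m needs [noC] or [noR]; two leaves are compared digit by
   digit; the other pairs differ at the index of an s or r vertex. *)
case: (val u) => [|l|m|m]; case: (val w) => [|l'|m'|m'] //= uw.
- by move=> _ /(_ l' erefl); rewrite noC.
- by have := uw m'; rewrite eqxx.
- by have := uw m'; rewrite eqxx.
- by move=> /(_ l erefl); rewrite noC.
- move=> _ _; congr Leaf; apply: eq_from_tnth => i; apply: val_inj.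
  by have [] := uw i.
- by have := uw m'; rewrite eqxx.
- by move=> /(_ l erefl); rewrite (noR l m').
- by have := uw m; rewrite eqxx.
- by have := uw m; rewrite eqxx.
- by have := uw m; rewrite eqxx; case: eqP => // ->.
- by have := uw m; rewrite eqxx; case: eqP.
- by have := uw m; rewrite eqxx.
- by move=> _ /(_ l' erefl); rewrite (noR l' m).
- by have := uw m'; rewrite eqxx; case: eqP.
- by have := uw m; rewrite eqxx; case: eqP => // ->.
Qed.

Lemma leafv_inj : {in [pred l | ~~ deleted_label l] &, injective (@leafv j)}.
Proof.
by move=> l l' hl hl' /(congr1 val); rewrite !val_leafv // => -[].
Qed.

(** The summands bound the deleted labels, the leaves in [T], and the distance vectors of the
    remaining leaves. *)
Lemma card_resolving (T : {set J j}) : k_resolving k T -> 3 ^ j <= j.+1 + #|T| + 3 ^ #|T|.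
Proof.
move/k_resolvingP => res.
pose D := [set l : label j | deleted_label l].
pose B := [set l : label j | ~~ deleted_label l && (leafv l \in T)].
have le_B : #|B| <= #|T|.
  rewrite -(card_in_imset (f := @leafv j) (D := mem B)); last first.
    by move=> l l'; rewrite !inE => /andP[hl _] /andP[hl' _]; apply: leafv_inj.
  by apply/subset_leq_card/subsetP => _ /imsetP[l + ->]; rewrite inE => /andP[].
(* Distances 1, 2, 3 are shifted to 0, 1, 2; no information is lost because 0 does not occur for
   leaves outside [T]. *)
pose f (l : label j) : {ffun 'I_#|T| -> 'I_3} :=
  [ffun i => inord (leaf_dist l (val (enum_val i))).-1].
have f_inj : {in ~: (D :|: B) &, injective f}.
  have pos l v : l \in ~: (D :|: B) -> v \in T -> 0 < leaf_dist l (val v).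
    rewrite !inE => /norP[hl]; rewrite hl /= => lT vT.
    rewrite -(@trunc_dist_leaf (leafv l) v) ?val_leafv // lt0n trunc_dist_eq0.
    by apply: contraNneq lT => ->.
  move=> l l' hl hl' /ffunP ll'.
  have kept t : t \in ~: (D :|: B) -> ~~ deleted_label t by rewrite !inE => /norP[].
  apply: leafv_inj; rewrite ?inE ?kept //; apply: res => v vT.
  rewrite (@trunc_dist_leaf _ _ l) ?val_leafv ?kept //.
  rewrite (@trunc_dist_leaf _ _ l') ?val_leafv ?kept //.
  have := ll' (enum_rank_in vT v); rewrite !ffunE enum_rankK_in //.
  have := pos _ _ hl vT; have := pos _ _ hl' vT.
  have := leaf_dist_le3 l (val v); have := leaf_dist_le3 l' (val v).
  move: (leaf_dist l _) (leaf_dist l' _) => p q q3 p3 q0 p0 /(congr1 val) /=.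
  by rewrite !inordK; lia.
have := card_in_imset f_inj; have := max_card (mem (f @: ~: (D :|: B))).
rewrite card_ffun !card_ord => le_f eq_f.
have := cardsC (D :|: B); rewrite card_tuple card_ord => <-.
rewrite -eq_f leq_add // (leq_trans (leq_card_setU _ _)) // leq_add //.
exact: card_deleted_label.
Qed.

Lemma dim_J : dim (J j) k = j.
Proof.
rewrite /dim; case: arg_minnP => [|T res min_T]; first exact: k_resolvingT.
apply/eqP; rewrite eqn_leq; apply/andP; split.
  apply: leq_trans (min_T _ S_resolving) _.
  by rewrite -[X in _ <= X]card_ord leq_imset_card.
(* With |T| <= j-1 the count gives 3^j <= 2j + 3^(j-1), hence 3^(j-1) <= j, which is false for j >=
   2. *)
rewrite leqNgt; apply/negP => lt_T; have := card_resolving res.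
have : 3 ^ #|T| <= 3 ^ j.-1 by rewrite leq_exp2l //; lia.
have -> : 3 ^ j = 3 * 3 ^ j.-1 by rewrite -expnS; congr (3 ^ _); lia.
have : j < 3 ^ j.-1.
  have -> : j.-1 = j.-2.+1 by lia.
  by rewrite expnS; have := ltn_expl j.-2 (isT : 1 < 3); lia.
by lia.
Qed.

End Distances.

(** * The fault-tolerant lower bound *)

Lemma ftdim_J k n : 1 < k -> 0 < n -> 3 ^ n - n.+1 <= ftdim (J n.+1) k.
Proof.
move=> hk hn; rewrite /ftdim; case: arg_minnP => [|T /andP[T0 /forall_inP ftT] _].
  exact: (ft_k_resolvingT k (vtx (Center n.+1))).
pose s0 : J n.+1 := vtx (Svert ord0).
(* One deletion yields a resolving set without [s0]: drop [s0] if present, otherwise any element. *)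
have [T' [sT' s0T' res]] : exists T' : {set J n.+1},
    [/\ T' \subset T, s0 \notin T' & k_resolving k T'].
  have [sT|nsT] := boolP (s0 \in T).
    by exists (T :\ s0); rewrite ftT // subD1set !inE eqxx.
  have [s sT] := set0Pn _ T0; exists (T :\ s).
  by rewrite ftT // subD1set !inE (negPf nsT) andbF.
apply: leq_trans (subset_leq_card sT'); move/k_resolvingP: res => res.
pose ext a (t : n.-tuple 'I_3) : label n.+1 := [tuple of a :: t].
pose lf a t := leafv (ext a t).
pose one3 : 'I_3 := inord 1.
have kept a t : t \notin [set l : label n | deleted_label l] -> ~~ deleted_label (ext a t).
  by rewrite inE; apply/contra/deleted_label_cons.
have lf_or t : t \notin [set l : label n | deleted_label l] ->
    (lf ord0 t \in T') || (lf one3 t \in T').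
  move=> ht; apply/negPn/negP => /norP[n0 n1].
  suff /(congr1 val) : lf ord0 t = lf one3 t.
    by rewrite !val_leafv ?kept // => -[] /(congr1 val); rewrite /= inordK.
  apply: res => v vT.
  rewrite (@trunc_dist_leaf _ _ hk _ _ _ (ext ord0 t)) ?val_leafv ?kept //.
  rewrite (@trunc_dist_leaf _ _ hk _ _ _ (ext one3 t)) ?val_leafv ?kept //.
  have nv a : lf a t \notin T' -> val v != Leaf (ext a t).
    apply: contraNneq => vE; rewrite (_ : lf a t = v) //.
    by apply: val_inj; rewrite val_leafv ?kept.
  have nvs : val v != Svert ord0.
    apply: contraNneq s0T' => vE; rewrite (_ : s0 = v) //.
    by apply: val_inj; rewrite val_S.
  (* The center and the other leaves see both leaves alike; for i > 0, s_i and r_i read only the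
     common tail; the first r vertex does not distinguish digits 0 and 1. *)
  case: (val v) (nv _ n0) (nv _ n1) nvs => [|l|i|i] //=.
  - move=> n0l n1l _.
    have nl t' : Leaf l != Leaf t' -> (t' == l) = false.
      by move=> ll'; apply/eqP => e; rewrite e eqxx in ll'.
    by rewrite (nl _ n0l) (nl _ n1l).
  - case: (unliftP ord0 i) => [m|] ->; last by rewrite eqxx.
    by rewrite !tnthS.
  - by case: (unliftP ord0 i) => [m|] ->; rewrite ?tnthS // !tnth0 /= inordK.
(* Picks a member of each pair lying in [T']; its label determines the tail, so [f] is injective on
   undeleted tails. *)
pose f t := if lf ord0 t \in T' then lf ord0 t else lf one3 t.
pose A : {set n.-tuple 'I_3} := ~: [set l : label n | deleted_label l].
have keptA a t : t \in A -> ~~ deleted_label (ext a t) by rewrite inE; apply: kept.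
have f_inj : {in A &, injective f}.
  move=> t t' tA tA'; have fE u : u \in A -> exists a, val (f u) = Leaf (ext a u).
    by move=> uA; rewrite /f; case: ifP => _; eexists; apply: val_leafv; apply: keptA.
  have [a ta] := fE t tA; have [b tb] := fE t' tA'.
  by move=> /(congr1 val); rewrite ta tb => -[_ tt']; apply: val_inj.
have card_A : #|A| <= #|T'|.
  rewrite -(card_in_imset f_inj); apply/subset_leq_card/subsetP => _ /imsetP[t tA ->].
  rewrite /f; case: ifP => // t0.
  by have := lf_or t; rewrite t0; apply; rewrite inE in tA.
have card3 : #|{: n.-tuple 'I_3}| = 3 ^ n by rewrite card_tuple card_ord.
rewrite leq_subLR -card3 -(cardsC [set l : label n | deleted_label l]).
by rewrite leq_add // card_deleted_label.
Qed.

(** The value of [dim] is claimed from j = 2 on, since [dim_J1] refutes it at j = 1. *)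
Theorem theorem24 (k j : nat) (hk : 2 <= k) (hj : 1 <= j) :
  (2 <= j -> dim (J j) k = j) /\ 3 ^ (j - 1) - j <= ftdim (J j) k.
Proof.
split; first exact: dim_J.
(* For j = 1 the lower bound is 3^0 - 1 = 0. *)
case: j hj => [|[|n]] // _; rewrite subn1 /=.
exact: ftdim_J.
Qed.
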